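(* Let $\{e_i\}_{i=1}^n$ be a basis of $\mathbb{R}^n$ and let $V:\mathrm{Pa}(\{e_i\}_{i=1}^n)\to\mathbb{R}$ be a translation invariant valuation. The following are equivalent: (1) $V$ is continuous; (2) there is a set $U\subset\mathbb{R}^n$ with nonempty interior such that $V$ is bounded on all parallelotopes inside $U$, i.e. $\sup\{|V(K)|:K\in\mathrm{Pa}(\{e_i\}_{i=1}^n),\ K\subset U\}<\infty$; (3) $V$ is Borel.
   Context: $\mathrm{Pa}(\{e_i\}_{i=1}^n)=\{\sum_{i=1}^n[a_i,b_i]e_i: a_i\le b_i\}$ is the set of (possibly degenerate, nonempty) compact parallelotopes with edges parallel to the basis vectors, where $\sum_{i=1}^n[a_i,b_i]e_i=\{\sum_i t_ie_i: t_i\in[a_i,b_i]\}$. It is equipped with the Hausdorff metric $d_H(K,L)=\min\{\varepsilon\ge0: K\subset L+\varepsilon B,\ L\subset K+\varepsilon B\}$, $B$ the closed Euclidean unit ball; continuity and Borel measurability are with respect to this metric. A map $V:\mathrm{Pa}(\{e_i\}_{i=1}^n)\to\mathbb{R}$ is a valuation if $V(K\cup L)+V(K\cap L)=V(K)+V(L)$ for all $K,L\in\mathrm{Pa}(\{e_i\}_{i=1}^n)$ with $K\cup L\in\mathrm{Pa}(\{e_i\}_{i=1}^n)$. It is translation invariant if $V(K+x)=V(K)$ for all $K\in\mathrm{Pa}(\{e_i\}_{i=1}^n)$ and $x\in\mathbb{R}^n$. *)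

(* Defs.v *)
From HB Require Import structures.
From mathcomp Require Import all_boot all_order all_algebra.
From mathcomp Require Import ring lra.
From mathcomp Require Import all_classical all_reals all_analysis.

Set Implicit Arguments.
Unset Strict Implicit.
Unset Printing Implicit Defensive.

Import Order.TTheory GRing.Theory Num.Theory.
Import numFieldNormedType.Exports.

Local Open Scope classical_set_scope.
Local Open Scope ring_scope.

Lemma continuous_sum {R : realType} {T : topologicalType} {V : normedModType R}
    (I : Type) (r : seq I) (f : I -> T -> V) :
  (forall i, continuous (f i)) -> continuous (fun x => \sum_(i <- r) f i x).
Proof.
move=> cf x; elim: r => [|i r IH].
  by under eq_fun do rewrite big_nil; exact: cvg_cst.
under eq_fun do rewrite big_cons.
by apply: cvgD; [exact: cf|exact: IH].
Qed.

(* The library norm `|x| on 'rV[R]_n is the sup norm: the Euclidean norm, which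
   enters the Hausdorff distance, has to be defined. Both norms induce the same
   topology on 'rV[R]_n. *)
Definition enorm {R : realType} {n : nat} (x : 'rV[R]_n) : R :=
  Num.sqrt (\sum_i x 0 i ^+ 2).

Section Enorm.
Context {R : realType} {n : nat}.
Implicit Types x y : 'rV[R]_n.

Let sumsq_ge0 x : 0 <= \sum_i x 0 i ^+ 2.
Proof. by apply: sumr_ge0 => i _; exact: sqr_ge0. Qed.

Lemma enorm_ge0 x : 0 <= enorm x.
Proof. exact: sqrtr_ge0. Qed.

Lemma enorm0 : enorm (0 : 'rV[R]_n) = 0.
Proof. by rewrite /enorm big1 ?sqrtr0// => i _; rewrite mxE expr0n. Qed.

Lemma enormZ (a : R) x : enorm (a *: x) = `|a| * enorm x.
Proof.
rewrite /enorm -sqrtr_sqr -sqrtrM ?sqr_ge0// mulr_sumr.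
by congr Num.sqrt; apply: eq_bigr => i _; rewrite mxE exprMn.
Qed.

Lemma enormN x : enorm (- x) = enorm x.
Proof. by rewrite -scaleN1r enormZ normrN1 mul1r. Qed.

Lemma enorm_eq0 x : enorm x = 0 -> x = 0.
Proof.
move/eqP; rewrite sqrtr_eq0 => x0; apply/rowP => i; rewrite mxE.
have /eqP : \sum_i x 0 i ^+ 2 = 0 by apply/eqP; rewrite eq_le x0 sumsq_ge0.
rewrite psumr_eq0; last by move=> j _; exact: sqr_ge0.
by move=> /allP/(_ i); rewrite mem_index_enum sqrf_eq0 => /(_ isT)/eqP.
Qed.

Lemma enorm_triangle x y : enorm (x + y) <= enorm x + enorm y.
Proof.
set A := \sum_i x 0 i ^+ 2; set C := \sum_i y 0 i ^+ 2.
pose B := \sum_i x 0 i * y 0 i.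
have BAC : B ^+ 2 <= A * C.
  have : 0 <= C by exact: sumsq_ge0.
  rewrite le_eqVlt => /orP[/eqP C0|C0].
    suff -> : B = 0 by rewrite expr0n -C0 mulr0.
    have y0 : y = 0 by apply: enorm_eq0; rewrite /enorm -/C -C0 sqrtr0.
    by rewrite /B big1// => i _; rewrite y0 mxE mulr0.
  have : 0 <= \sum_i (C * x 0 i - B * y 0 i) ^+ 2.
    by apply: sumr_ge0 => i _; exact: sqr_ge0.
  have -> : \sum_i (C * x 0 i - B * y 0 i) ^+ 2 = C * (A * C - B ^+ 2).
    under eq_bigr => i _.
      have -> : (C * x 0 i - B * y 0 i) ^+ 2 =
        C ^+ 2 * x 0 i ^+ 2 - 2 * B * C * (x 0 i * y 0 i) + B ^+ 2 * y 0 i ^+ 2.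
        by ring.
      over.
    rewrite big_split sumrB/= -!mulr_sumr -/A -/B -/C; ring.
  by rewrite pmulr_rge0// subr_ge0.
rewrite -ler_sqr ?nnegrE ?addr_ge0 ?enorm_ge0//.
rewrite sqrrD /enorm !sqr_sqrtr ?sumsq_ge0// -/A -/C.
have -> : \sum_i (x + y) 0 i ^+ 2 = A + B *+ 2 + C.
  rewrite /A /B /C -sumrMnl -!big_split/=.
  by apply: eq_bigr => i _; rewrite mxE; ring.
rewrite lerD2r lerD2l lerMn2r/= -sqrtrM ?sumsq_ge0//.
by rewrite (le_trans (ler_norm _))// -sqrtr_sqr ler_wsqrtr.
Qed.

Lemma enorm_continuous : continuous (@enorm R n).
Proof.
move=> x; apply: (@continuous_comp _ _ _ (fun x => \sum_i x 0 i ^+ 2) Num.sqrt).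
  apply: (@continuous_sum R 'rV[R]_n R) => i y.
  apply: (@continuous_comp _ _ _ (fun x : 'rV[R]_n => x 0 i) (fun t => t ^+ 2)).
    exact: coord_continuous.
  exact: exprn_continuous.
exact: sqrt_continuous.
Qed.

End Enorm.

Section HausdorffDistance.
Context {R : realType} {n : nat}.
Implicit Types (K L M : set 'rV[R]_n) (eps : R).

Definition unit_ball : set 'rV[R]_n := [set x | enorm x <= 1].

(* L + eps B *)
Definition thickening L eps : set 'rV[R]_n :=
  [set y + eps *: b | y in L & b in unit_ball].

Definition hausdorff_bounds K L : set R :=
  [set eps | [/\ 0 <= eps, K `<=` thickening L eps & L `<=` thickening K eps]].

(* For nonempty compact sets the infimum is a minimum: see
   hausdorff_dist_attained. *)
Definition hausdorff_dist K L : R := inf (hausdorff_bounds K L).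

Lemma thickeningP L eps x : 0 <= eps ->
  thickening L eps x <-> exists2 y, L y & enorm (x - y) <= eps.
Proof.
rewrite /thickening /unit_ball/= => eps0; split.
  case=> y Ly [b /= b1 <-]; exists y => //.
  by rewrite addrC addKr enormZ ger0_norm// ler_piMr.
case=> y Ly xy; exists y => //; move: eps0; rewrite le_eqVlt => /predU1P[e0|e0].
  exists 0; rewrite /= ?enorm0// scaler0 addr0; apply/esym/eqP.
  rewrite -subr_eq0; apply/eqP/enorm_eq0/eqP.
  by rewrite eq_le enorm_ge0 andbT e0.
exists (eps^-1 *: (x - y)) => /=.
  by rewrite enormZ ger0_norm ?invr_ge0 ?(ltW e0)// mulrC ler_pdivrMr// mul1r.
by rewrite scalerA divff ?gt_eqF// scale1r addrC subrK.
Qed.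

Lemma hausdorff_bounds_ge0 K L : lbound (hausdorff_bounds K L) 0.
Proof. by move=> eps []. Qed.

Lemma hausdorff_bounds_sym K L : hausdorff_bounds K L = hausdorff_bounds L K.
Proof. by apply/seteqP; split=> eps []. Qed.

Let compact_nearest L (x : 'rV[R]_n) : L !=set0 -> compact L ->
  exists2 y, L y & forall z, L z -> enorm (x - y) <= enorm (x - z).
Proof.
move=> L0 cL; have [|y] := @compact_EVT_min _ _ (fun z : 'rV[R]_n => enorm (x - z)) _ L0 cL.
  apply: continuous_subspaceT => z.
  apply: (@continuous_comp _ _ _ (fun z : 'rV[R]_n => x - z) enorm).
    exact: (cvgB (cvg_cst x) (@cvg_id _ (nbhs z))).
  exact: enorm_continuous.
rewrite inE => Ly h; exists y => // z Lz; exact: (h z (mem_set Lz)).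
Qed.

Let compact_ebounded L : L !=set0 -> compact L ->
  exists B : R, forall z, L z -> enorm z <= B.
Proof.
move=> L0 cL; have [|y _ h] := @compact_EVT_max _ _ enorm _ L0 cL.
  by apply: continuous_subspaceT => z; exact: enorm_continuous.
by exists (enorm y) => z Lz; exact: (h z (mem_set Lz)).
Qed.

Lemma hausdorff_bounds_nonempty K L :
  K !=set0 -> compact K -> L !=set0 -> compact L -> hausdorff_bounds K L !=set0.
Proof.
move=> K0 cK L0 cL.
have [a Ka] := compact_ebounded K0 cK; have [b Lb] := compact_ebounded L0 cL.
case: K0 L0 => [x Kx] [y Ly].
have ab0 : 0 <= a + b.
  apply: addr_ge0; first exact: le_trans (enorm_ge0 _) (Ka _ Kx).
  exact: le_trans (enorm_ge0 _) (Lb _ Ly).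
exists (a + b); split=> // z Hz; apply/thickeningP => //.
  exists y => //; rewrite (le_trans (enorm_triangle _ _))// enormN.
  by rewrite lerD ?Ka ?Lb.
exists x => //; rewrite (le_trans (enorm_triangle _ _))// enormN addrC.
by rewrite lerD ?Ka ?Lb.
Qed.

Lemma hausdorff_dist_ge0 K L : 0 <= hausdorff_dist K L.
Proof.
have [h|/set0P/negP/negPn/eqP h] := pselect (hausdorff_bounds K L !=set0).
  exact: lb_le_inf h (@hausdorff_bounds_ge0 K L).
by rewrite /hausdorff_dist h inf0.
Qed.

Lemma hausdorff_dist_sym K L : hausdorff_dist K L = hausdorff_dist L K.
Proof. by rewrite /hausdorff_dist hausdorff_bounds_sym. Qed.

Let hausdorff_dist_sub K L :
  K !=set0 -> compact K -> L !=set0 -> compact L ->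
  K `<=` thickening L (hausdorff_dist K L).
Proof.
move=> K0 cK L0 cL x Kx; apply/thickeningP; first exact: hausdorff_dist_ge0.
have [y Ly h] := compact_nearest x L0 cL; exists y => //.
apply: lb_le_inf => [|eps]; first exact: hausdorff_bounds_nonempty.
move=> [eps0 /(_ _ Kx) /(thickeningP _ _ eps0)[z Lz xz] _].
exact: le_trans (h _ Lz) xz.
Qed.

Lemma hausdorff_dist_attained K L :
  K !=set0 -> compact K -> L !=set0 -> compact L ->
  hausdorff_bounds K L (hausdorff_dist K L).
Proof.
move=> K0 cK L0 cL; split; first exact: hausdorff_dist_ge0.
  exact: hausdorff_dist_sub.
by rewrite hausdorff_dist_sym; exact: hausdorff_dist_sub.
Qed.

Lemma hausdorff_dist_le K L eps :
  hausdorff_bounds K L eps -> hausdorff_dist K L <= eps.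
Proof. by apply: ge_inf; exists 0; exact: hausdorff_bounds_ge0. Qed.

Lemma hausdorff_distxx K : hausdorff_dist K K = 0.
Proof.
apply/eqP; rewrite eq_le hausdorff_dist_ge0 andbT; apply: hausdorff_dist_le.
by split=> // x Kx; apply/thickeningP => //; exists x; rewrite // subrr enorm0.
Qed.

Lemma hausdorff_dist_eq0 K L :
  K !=set0 -> compact K -> L !=set0 -> compact L ->
  hausdorff_dist K L = 0 -> K = L.
Proof.
move=> K0 cK L0 cL d0; have [_] := hausdorff_dist_attained K0 cK L0 cL.
have sub0 M x : thickening M 0 x -> M x.
  move=> /(thickeningP _ _ (lexx 0))[y My xy].
  suff -> : x = y by [].
  apply/eqP; rewrite -subr_eq0; apply/eqP/enorm_eq0/eqP.
  by rewrite eq_le xy enorm_ge0.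
by rewrite d0 => KL LK; apply/seteqP; split=> x /[dup] ? => [/KL|/LK]; exact: sub0.
Qed.

Let thickening_trans K L M d1 d2 : 0 <= d1 -> 0 <= d2 ->
  K `<=` thickening L d1 -> L `<=` thickening M d2 ->
  K `<=` thickening M (d1 + d2).
Proof.
move=> d10 d20 KL LM x /KL /(thickeningP _ _ d10)[y /LM].
move=> /(thickeningP _ _ d20)[z Mz yz] xy; apply/thickeningP; first exact: addr_ge0.
exists z => //; rewrite -(subrK y x) -addrA.
by rewrite (le_trans (enorm_triangle _ _))// lerD.
Qed.

Lemma hausdorff_dist_triangle L K M :
  K !=set0 -> compact K -> L !=set0 -> compact L -> M !=set0 -> compact M ->
  hausdorff_dist K M <= hausdorff_dist K L + hausdorff_dist L M.
Proof.
move=> K0 cK L0 cL M0 cM; apply: hausdorff_dist_le.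
have [? KL LK] := hausdorff_dist_attained K0 cK L0 cL.
have [? LM ML] := hausdorff_dist_attained L0 cL M0 cM.
split; first exact: addr_ge0.
  exact: thickening_trans KL LM.
by rewrite addrC; exact: thickening_trans ML LK.
Qed.

End HausdorffDistance.
Arguments unit_ball {R n}.

Section Parallelotopes.
Context {R : realType} {n : nat}.
Implicit Types (e : n.-tuple 'rV[R]_n) (a b t x : 'rV[R]_n).

(* The coefficients of a linear combination, and the bounds a_i, b_i of a
   parallelotope, are packed in row vectors. *)
Definition lincomb e t : 'rV[R]_n := \sum_i t 0 i *: e`_i.

(* \sum_i [a_i, b_i] e_i *)
Definition parallelotope e a b : set 'rV[R]_n :=
  [set lincomb e t | t in [set t : 'rV[R]_n | forall i, a 0 i <= t 0 i <= b 0 i]].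

Definition is_para e (K : set 'rV[R]_n) : Prop :=
  exists a b, (forall i, a 0 i <= b 0 i) /\ K = parallelotope e a b.

(* Pa(e), for an arbitrary family e of n vectors *)
Record para e := Para {
  para_set :> set 'rV[R]_n;
  para_setP : is_para e para_set }.

Lemma para_inj e (K L : para e) : K = L :> set _ -> K = L.
Proof.
case: K L => [K pK] [L pL] /= KL; case: _ / KL pL => pL.
by congr Para; exact: Prop_irrelevance.
Qed.

Lemma is_para_nonempty e K : is_para e K -> K !=set0.
Proof.
move=> [a [b [ab ->]]]; exists (lincomb e a), a => //= i.
by rewrite lexx ab.
Qed.

Lemma is_para_compact e K : is_para e K -> compact K.
Proof.
move=> [a [b [_ ->]]]; apply: continuous_compact.
  apply: continuous_subspaceT; rewrite /lincomb.
  apply: (@continuous_sum R 'rV[R]_n 'rV[R]_n) => i t.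
  apply: (@cvgZr_tmp _ _ _ _ _ (fun t : 'rV[R]_n => t 0 i) (t 0 i)); first exact: nbhs_filter.
  exact: (@coord_continuous R 1 n 0 i t).
rewrite [X in compact X](_ : _ =
    [set t : 'rV[R]_n | forall i, `[a 0 i, b 0 i]%classic (t 0 i)]).
  apply: (@rV_compact R n (fun i => `[a 0 i, b 0 i]%classic)) => i.
  exact: segment_compact.
by apply/seteqP; split=> t /= h i; have := h i; rewrite in_itv.
Qed.

Lemma is_para0 e : is_para e (parallelotope e 0 0).
Proof. by exists 0, 0. Qed.

Lemma basis_coordE e : basis_of fullv e ->
  forall x, x = lincomb e (\row_i coord e i x).
Proof.
move=> be x; rewrite {1}(coord_basis be (memvf x)).
by apply: eq_bigr => i _; rewrite mxE.
Qed.

Lemma basis_sum_inj e : basis_of fullv e ->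
  injective (lincomb e).
Proof.
move=> be t t' /= tt'; apply/rowP => i.
have fe := basis_free be.
have := congr1 (coord e i) tt'.
by rewrite (coord_sum_free (fun i => t 0 i) i fe) (coord_sum_free (fun i => t' 0 i) i fe).
Qed.

Lemma parallelotopeP e a b t : basis_of fullv e ->
  parallelotope e a b (lincomb e t) <->
  forall i, a 0 i <= t 0 i <= b 0 i.
Proof.
move=> be; split=> [[t' /= h] /(basis_sum_inj be) <- //|h]; by exists t.
Qed.

Lemma is_para_shift e K x : basis_of fullv e -> is_para e K ->
  is_para e [set y + x | y in K].
Proof.
move=> be [a [b [ab ->]]]; pose u := \row_i coord e i x.
have sumD t v : lincomb e (t + v) = lincomb e t + lincomb e v.
  by rewrite /lincomb -big_split/=; apply: eq_bigr => i _; rewrite mxE scalerDl.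
exists (a + u), (b + u); split=> [i|]; first by rewrite !mxE lerD2r.
rewrite (basis_coordE be x) -/u; apply/seteqP; split=> [_ [_ [t /= h <-] <-]|].
  by exists (t + u) => [i|]; [rewrite !mxE !lerD2r; have := h i|rewrite sumD].
move=> _ [t /= h <-]; exists (lincomb e (t - u)); last first.
  by rewrite -sumD subrK.
exists (t - u) => // i; rewrite !mxE lerBrDr lerBlDr.
by have := h i; rewrite !mxE.
Qed.

(* K `|` L being a parallelotope forces K and L to meet, so that their
   intersection is again in Pa(e). *)
Lemma is_paraI e K L : basis_of fullv e -> is_para e K -> is_para e L ->
  is_para e (K `|` L) -> is_para e (K `&` L).
Proof.
move=> be [a [b [ab ->]]] [c [d [cd ->]]] [p [q [pq KL]]].
pose l := \row_i Num.max (a 0 i) (c 0 i); pose m := \row_i Num.min (b 0 i) (d 0 i).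
exists l, m; split; last first.
  apply/seteqP; split=> x.
    rewrite (basis_coordE be x); move: (\row_i _) => t {x}.
    case=> /(parallelotopeP _ _ _ be) h1 /(parallelotopeP _ _ _ be) h2.
    apply/(parallelotopeP _ _ _ be) => i; rewrite !mxE ge_max le_min.
    by have /andP[-> ->] := h1 i; have /andP[-> ->] := h2 i.
  rewrite (basis_coordE be x); move: (\row_i _) => t {x}.
  move=> /(parallelotopeP _ _ _ be) h.
  by split; apply/(parallelotopeP _ _ _ be) => i; have := h i;
    rewrite !mxE ge_max le_min => /andP[/andP[? ?] /andP[? ?]]; apply/andP.
have inK t : (forall i, a 0 i <= t 0 i <= b 0 i) ->
    forall i, p 0 i <= t 0 i <= q 0 i.
  move=> h; apply/(parallelotopeP _ _ _ be); rewrite -KL; left.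
  exact/(parallelotopeP _ _ _ be).
have inL t : (forall i, c 0 i <= t 0 i <= d 0 i) ->
    forall i, p 0 i <= t 0 i <= q 0 i.
  move=> h; apply/(parallelotopeP _ _ _ be); rewrite -KL; right.
  exact/(parallelotopeP _ _ _ be).
have pa i : p 0 i <= a 0 i <= q 0 i by apply: inK => j; rewrite lexx ab.
have pb i : p 0 i <= b 0 i <= q 0 i by apply: inK => j; rewrite lexx ab.
have pc i : p 0 i <= c 0 i <= q 0 i by apply: inL => j; rewrite lexx cd.
have pd i : p 0 i <= d 0 i <= q 0 i by apply: inL => j; rewrite lexx cd.
have split_ t : (forall i, p 0 i <= t 0 i <= q 0 i) ->
    (forall i, a 0 i <= t 0 i <= b 0 i) \/ (forall i, c 0 i <= t 0 i <= d 0 i).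
  move=> /(parallelotopeP _ _ _ be); rewrite -KL.
  by case=> /(parallelotopeP _ _ _ be); [left|right].
have gap i r : p 0 i <= r <= q 0 i ->
    (a 0 i <= r <= b 0 i) \/ (c 0 i <= r <= d 0 i).
  move=> hr; pose t : 'rV[R]_n := \row_j if j == i then r else a 0 j.
  have /split_[] : forall j, p 0 j <= t 0 j <= q 0 j.
  - by move=> j; rewrite mxE; case: eqP => [->|].
  - by move=> /(_ i); rewrite mxE eqxx; left.
  - by move=> /(_ i); rewrite mxE eqxx; right.
clear KL be; move=> i; rewrite !mxE ge_max !le_min ab cd andbT/=.
have /andP[? ?] := pa i; have /andP[? ?] := pb i.
have /andP[? ?] := pc i; have /andP[? ?] := pd i.
have ? := ab i; have ? := cd i.
apply/andP; split; rewrite leNgt; apply/negP => h.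
  have [] := gap i ((d 0 i + a 0 i) / 2); first (by apply/andP; split; lra);
    by move=> /andP[? ?]; lra.
have [] := gap i ((b 0 i + c 0 i) / 2); first (by apply/andP; split; lra);
  by move=> /andP[? ?]; lra.
Qed.

Section ParaMetric.
Variable e : n.-tuple 'rV[R]_n.

HB.instance Definition _ := gen_eqMixin (para e).
HB.instance Definition _ := gen_choiceMixin (para e).

Let para_dist (K L : para e) : R := hausdorff_dist K L.

Let para_nonempty (K : para e) : (K : set _) !=set0.
Proof. exact: is_para_nonempty (para_setP K). Qed.

Let para_compact (K : para e) : compact (K : set _).
Proof. exact: is_para_compact (para_setP K). Qed.

Let para_distxx K : para_dist K K = 0.
Proof. exact: hausdorff_distxx. Qed.

Let para_dist_positivity K L : para_dist K L = 0 -> K = L.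
Proof. by move=> KL; apply/para_inj/hausdorff_dist_eq0. Qed.

Let para_dist_sym K L : para_dist K L = para_dist L K.
Proof. exact: hausdorff_dist_sym. Qed.

Let para_dist_triangle L K M : para_dist K M <= para_dist K L + para_dist L M.
Proof. exact: hausdorff_dist_triangle. Qed.

(* Pa(e) with the Hausdorff distance *)
HB.instance Definition _ := isMetric.Build R (para e)
  para_distxx para_dist_positivity para_dist_sym para_dist_triangle.

HB.instance Definition _ := isPointed.Build (para e) (Para (is_para0 e)).

End ParaMetric.
End Parallelotopes.

Lemma para_mdistE (R : realType) (n : nat) (e : n.-tuple 'rV[R]_n)
    (K L : para e) : mdist K L = hausdorff_dist K L.
Proof. by []. Qed.

Section Valuations.
Context {R : realType} {n : nat} {e : n.-tuple 'rV[R]_n}.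
Implicit Types (V : para e -> R).

(* M and N stand for K `|` L and K `&` L; the existence of N is is_paraI. *)
Definition is_valuation V : Prop :=
  forall K L M N : para e, M = K `|` L :> set _ -> N = K `&` L :> set _ ->
    V M + V N = V K + V L.

(* L stands for K + x, which exists by is_para_shift. *)
Definition translation_invariant V : Prop :=
  forall (K L : para e) (x : 'rV[R]_n), L = [set y + x | y in K] :> set _ ->
    V L = V K.

Definition borel_measurable V : Prop :=
  measurable_fun [set: g_sigma_algebraType (@open (para e))]
    (V : g_sigma_algebraType (@open (para e)) -> R).

End Valuations.

(* Main.v *)
Require Import Defs.
From mathcomp Require Import all_boot all_order all_algebra.
From mathcomp Require Import ring lra.
From mathcomp Require Import all_classical all_reals all_analysis.
From mathcomp Require Import measurable_realfun.

Set Implicit Arguments.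
Unset Strict Implicit.
Unset Printing Implicit Defensive.

Import Order.TTheory GRing.Theory Num.Theory.
Import numFieldNormedType.Exports.

Local Open Scope classical_set_scope.
Local Open Scope ring_scope.

(** By translation invariance, V(K) depends only on the widths w_i = b_i - a_i
    of K = \sum_i [a_i, b_i] e_i: V(K) = F(w), where F(w) is the value of V at
    the box with one corner at the origin. Cutting a box by a hyperplane
    parallel to all the basis vectors but e_i and applying the valuation property
    shows that, in each variable separately, F(w) - F(w with w_i = 0) is additive
    on the nonnegative half-line ([coordwise_valuation_box]). So everything is
    about Cauchy's functional equation on [0, +oo[, whose solutions are linear as
    soon as they are bounded on [0, 1] ([nneg_additive_linear]) or measurable
    ([measurable_nneg_additive_bounded], by a Steinhaus argument).

    If V is bounded on the parallelotopes inside a set with nonempty interior,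
    then F is bounded on some cube [0, d]^n, and additivity in each variable
    propagates the bound to every cube ([bounded_enlarge]); if V is Borel, then
    s |-> F(w with w_i = s) is Borel, because boxes depend continuously on their
    widths. In both cases F is affine in each variable ([bounded_affine],
    [measurable_affine]).

    A function that is affine in each variable is a polynomial in the widths, and
    the widths are Lipschitz for the Hausdorff distance ([widths_lipschitz]), so V
    is continuous ([affine_continuous]). Conversely, a continuous V is Borel, and
    it is bounded near the singleton {0}, that is on all the parallelotopes
    contained in a small ball. *)

(** * Cauchy's functional equation on the nonnegative half-line *)

Section Cauchy.
Context {R : realType}.
Implicit Types (g : R -> R) (s t : R).

Definition nneg_additive g := forall s t, 0 <= s -> 0 <= t ->
  g (s + t) = g s + g t.

Lemma nneg_additiveMn g s m : nneg_additive g -> 0 <= s ->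
  g (s *+ m) = g s *+ m.
Proof.
move=> ga s0; elim: m => [|m IH].
  rewrite !mulr0n; have := ga 0 0 (lexx _) (lexx _); rewrite addr0; lra.
by rewrite !mulrS ga ?mulrn_wge0// IH.
Qed.

(** Subtracting the linear function s * g 1 leaves an additive function h with
    h 1 = 0: it is 1-periodic, hence bounded on the whole half-line, and
    h (m s) = m h s then forces h = 0. *)
Lemma nneg_additive_linear g C : nneg_additive g ->
  (forall s, 0 <= s <= 1 -> `|g s| <= C) ->
  forall s, 0 <= s -> g s = s * g 1.
Proof.
move=> ga gC; pose h s := g s - s * g 1.
have ha : nneg_additive h by move=> s t s0 t0; rewrite /h ga//; ring.
have hC s : 0 <= s -> `|h s| <= C + C.
  move=> s0; have /andP[ms sm] := truncn_itv s0.
  set m := Num.trunc s in ms sm.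
  have r0 : 0 <= s - m%:R by rewrite subr_ge0.
  have r1 : s - m%:R <= 1 by rewrite lerBlDl natr1 ltW.
  have -> : h s = h (s - m%:R).
    rewrite -[in LHS](subrK m%:R s) (ha _ _ r0 (ler0n _ m)).
    rewrite (nneg_additiveMn m ha ler01).
    by rewrite [h 1]/h mul1r subrr mul0rn addr0.
  rewrite /h (le_trans (ler_normB _ _))// lerD ?gC ?r0//.
  by rewrite normrM ger0_norm// (le_trans _ (gC 1 _)) ?ler_piMl ?ler01 ?lexx.
move=> s s0; apply/eqP; rewrite -subr_eq0 -/(h s); apply/negPn/negP => hs0.
have hs : 0 < `|h s| by rewrite normr_gt0.
have := hC (s *+ (Num.trunc ((C + C) / `|h s|)).+1) (mulrn_wge0 _ s0).
rewrite nneg_additiveMn// normrMn -mulr_natl -ler_pdivlMr// leNgt.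
by rewrite truncnS_gt.
Qed.

Local Notation mu := (@lebesgue_measure R).

Lemma lebesgue_measure_translate t (A : set R) : measurable A ->
  mu ((fun s => s + t) @^-1` A) = mu A.
Proof.
move=> mA; pose f := (fun s => s + t) : measurableTypeR R -> measurableTypeR R.
have mf : measurable_fun setT f by exact: measurable_funD.
rewrite -[LHS]/(pushforward mu f A).
apply/esym/lebesgue_measure_unique => //= _ [[a b]] _ <-.
rewrite /pushforward /f.
have -> : (fun s : R => s + t) @^-1` [set` `]a, b]] = [set` `]a - t, b - t]].
  by apply/seteqP; split=> s /=; rewrite !in_itv/= ltrBlDr lerBrDr.
rewrite !lebesgue_measure_itv/= !lte_fin ltrD2r.
by case: ifP => // _; rewrite -!EFinB; congr EFin; ring.
Qed.

(** If A and A + t were disjoint, their union would have measure more than 3/2,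
    while it lies in [0, 3/2]. *)
Lemma steinhaus_unit (A : set R) : measurable A -> A `<=` `[0, 1] ->
  ((3 / 4)%:E < mu A)%E ->
  forall t, 0 <= t <= 1 / 2 -> exists2 s, A s & A (s + t).
Proof.
move=> mA A01 muA t /andP[t0 t1]; apply: contrapT => nt.
pose B := (fun s => s + - t) @^-1` A.
have mB : measurable B.
  by rewrite -[B]setTI; apply: (measurable_funD _ _ _ _) => //.
have AB0 : A `&` B = set0.
  rewrite -subset0 => s [As]; rewrite /B /= => Bs; apply: nt.
  by exists (s - t) => //; rewrite subrK.
have muB : mu B = mu A by rewrite /B lebesgue_measure_translate.
have : (mu (A `|` B) <= (3 / 2)%:E)%E.
  have -> : (3 / 2)%:E = mu [set` `[0%R, (3 / 2 : R)]].
    rewrite lebesgue_measure_itv/= lte_fin ifT; last lra.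
    by rewrite -EFinB subr0.
  apply: le_measure; rewrite ?inE//; first exact: measurableU.
  move=> s [/A01|/A01] /=; rewrite !in_itv/= => /andP[? ?]; apply/andP; split; lra.
have -> : mu (A `|` B) = (mu A + mu A)%E.
  by rewrite -[X in (_ + X)%E]muB; exact: measureU.
rewrite leNgt => /negP; apply.
have -> : (3 / 2 = 3 / 4 + 3 / 4 :> R) by lra.
by rewrite EFinD lteD.
Qed.

(** The sets where |g| <= m increase to [0, 1], so one of them has measure more
    than 3/4, and every t in [0, 1/2] is a difference of two of its elements:
    this bounds g on [0, 1/2], and then on [0, 1] by additivity. *)
Lemma measurable_nneg_additive_bounded g : measurable_fun setT g -> nneg_additive g ->
  exists C, forall s, 0 <= s <= 1 -> `|g s| <= C.
Proof.
move=> mg ga; pose A (m : nat) := `[0, 1] `&` g @^-1` `[- m%:R, m%:R].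
have mA m : measurable (A m).
  by apply: measurableI => //; rewrite -[X in measurable X]setTI; exact: mg.
have AT : \bigcup_m A m = `[0, 1]%classic.
  apply/seteqP; split=> [s [m _ []]//|s s01].
  exists (Num.trunc `|g s|).+1 => //; split=> //=.
  by rewrite in_itv/= -ler_norml ltW// truncnS_gt.
have ndA : {homo A : m p / (m <= p)%N >-> (m <= p)%O}.
  move=> m p mp; apply/subsetPset => s [s01]; rewrite /= in_itv/= -ler_norml => gs.
  by split=> //=; rewrite in_itv/= -ler_norml (le_trans gs)// ler_nat.
have [m muAm] : exists m, ((3 / 4)%:E < mu (A m))%E.
  have muAT : mu (\bigcup_m A m) = 1%:E.
    by rewrite AT lebesgue_measure_itv/= lte_fin ltr01 -EFinB subr0.
  have cA : (mu \o A) m @[m --> \oo] --> (1%:E : \bar R).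
    by rewrite -muAT; apply: nondecreasing_cvg_mu => //; rewrite AT; exact: measurable_itv.
  have /cA[] : nbhs (1%:E : \bar R) [set x | ((3 / 4)%:E < x)%E].
    by apply: open_nbhs_nbhs; split; [exact: open_ereal_gt_ereal|rewrite /= lte_fin; lra].
  by move=> m _ /(_ m (leqnn m)) /= ?; exists m.
have half t : 0 <= t <= 1 / 2 -> `|g t| <= m%:R + m%:R.
  move=> /[dup] t12 /(steinhaus_unit (mA m) (@subIsetl _ _ _) muAm).
  case=> s [/=]; rewrite !in_itv/= -!ler_norml => /andP[s0 _] gs.
  move=> [_ /=]; rewrite in_itv/= -ler_norml => gst.
  have -> : g t = g (s + t) - g s by rewrite ga//; [ring|case/andP: t12].
  by rewrite (le_trans (ler_normB _ _))// lerD.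
exists ((m%:R + m%:R) + (m%:R + m%:R)) => s /andP[s0 s1].
have -> : s = s / 2 + s / 2 by lra.
have s2 : 0 <= s / 2 <= 1 / 2 by apply/andP; split; lra.
rewrite ga; try lra.
by rewrite (le_trans (ler_normD _ _))// lerD// half.
Qed.

End Cauchy.

(** * Functions of several nonnegative variables *)

Section Coordinatewise.
Context {R : realType} {n : nat}.
Implicit Types (w : 'rV[R]_n) (i j : 'I_n) (s t : R) (F : 'rV[R]_n -> R).

Definition set_coord w i s : 'rV[R]_n := \row_j (if j == i then s else w 0 j).

Lemma set_coord_id w i : set_coord w i (w 0 i) = w.
Proof. by apply/rowP => j; rewrite mxE; case: eqP => [->|]. Qed.

Definition nneg w := forall i, 0 <= w 0 i.

Lemma nneg_set_coord w i s : nneg w -> 0 <= s -> nneg (set_coord w i s).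
Proof. by move=> w0 s0 j; rewrite mxE; case: ifP. Qed.

(** The trace of the valuation property on a function of the widths: the four
    terms come from a box cut across its i-th edges, the two pieces and their
    common facet. *)
Definition coordwise_valuation F := forall w i s t, nneg w -> 0 <= s -> 0 <= t ->
  F (set_coord w i (s + t)) + F (set_coord w i 0) =
  F (set_coord w i s) + F (set_coord w i t).

Definition coordwise_affine F := forall w i s, nneg w -> 0 <= s ->
  F (set_coord w i s) =
  F (set_coord w i 0) + s * (F (set_coord w i 1) - F (set_coord w i 0)).

Definition increment F w i s := F (set_coord w i s) - F (set_coord w i 0).

Lemma nneg_additive_increment F w i : coordwise_valuation F -> nneg w ->
  nneg_additive (increment F w i).
Proof.
move=> Fv w0 s t s0 t0; have := Fv w i s t w0 s0 t0.
rewrite /increment; lra.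
Qed.

Lemma bounded_increment_affine F : coordwise_valuation F ->
  (forall w i, nneg w ->
    exists C, forall s, 0 <= s <= 1 -> `|increment F w i s| <= C) ->
  coordwise_affine F.
Proof.
move=> Fv Fb w i s w0 s0; have [C FC] := Fb w i w0.
have := nneg_additive_linear (nneg_additive_increment i Fv w0) FC s0.
rewrite /increment; lra.
Qed.

Lemma measurable_affine F : coordwise_valuation F ->
  (forall w i, nneg w -> measurable_fun setT (fun s => F (set_coord w i s))) ->
  coordwise_affine F.
Proof.
move=> Fv Fm; apply: (bounded_increment_affine Fv) => w i w0.
apply: measurable_nneg_additive_bounded; last exact: nneg_additive_increment.
by apply: measurable_funD; [exact: Fm|exact: measurable_cst].
Qed.

(** The variables are enlarged one at a time. To enlarge the k-th one, divide it
    by an integer m with M <= m d and use that the increment of F is additive. *)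
Lemma bounded_enlarge F (d C : R) : coordwise_valuation F -> 0 < d ->
  (forall w, (forall j, 0 <= w 0 j <= d) -> `|F w| <= C) ->
  forall M, exists C', forall w, (forall j, 0 <= w 0 j <= M) -> `|F w| <= C'.
Proof.
move=> Fv d0 Fd M.
(* The first k variables are allowed up to M, the others only up to d. *)
suff H k : (k <= n)%N -> exists C', forall w,
    (forall j, 0 <= w 0 j <= if (j < k)%N then M else d) -> `|F w| <= C'.
  have [C' FC] := H n (leqnn n); exists C' => w wM; apply: FC => j.
  by rewrite ltn_ord.
elim: k => [_|k IH kn]; first by exists C => w wd; apply: Fd => j; exact: wd.
have [C' FC] := IH (ltnW kn); pose i := Ordinal kn.
pose m := (Num.trunc (M / d)).+1.
exists (C' + (C' + C') *+ m) => w wM.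
have w0 : nneg w by move=> j; case/andP: (wM j).
have m0 : 0 < m%:R :> R by rewrite ltr0n.
have wi : 0 <= w 0 i / m%:R <= d.
  rewrite divr_ge0 ?w0 ?ler0n//= ler_pdivrMr// mulrC -ler_pdivrMr//.
  have /andP[_] := wM i; rewrite ltnSn => wiM.
  by rewrite (le_trans _ (ltW (truncnS_gt (M / d))))// ler_pM2r ?invr_gt0.
have small s : 0 <= s <= d -> `|F (set_coord w i s)| <= C'.
  move=> sd; apply: FC => j; rewrite mxE; case: eqP => [->|/eqP ji].
    by rewrite ltnn.
  have := wM j; rewrite ltnS leq_eqVlt; suff -> : (j == k :> nat) = false by [].
  by apply/negbTE; move: ji; rewrite -val_eqE.
have F0 : `|F (set_coord w i 0)| <= C' by apply: small; rewrite lexx ltW.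
have -> : F w = F (set_coord w i 0) + increment F w i (w 0 i / m%:R) *+ m.
  rewrite -nneg_additiveMn; last 2 first.
  - exact: nneg_additive_increment.
  - by case/andP: wi.
  by rewrite -[_ / _ *+ m]mulr_natr divfK ?gt_eqF// /increment set_coord_id addrC subrK.
rewrite (le_trans (ler_normD _ _))// lerD// normrMn lerMn2r.
by rewrite (le_trans (ler_normB _ _)) ?orbT// lerD// small.
Qed.

Lemma bounded_affine F (d C : R) : coordwise_valuation F -> 0 < d ->
  (forall w, (forall j, 0 <= w 0 j <= d) -> `|F w| <= C) ->
  coordwise_affine F.
Proof.
move=> Fv d0 Fd; apply: (bounded_increment_affine Fv) => w i w0.
(* A bound for all the coordinates of w and for the interval [0, 1]. *)
pose M := 1 + \sum_j w 0 j.
have [C' FC] := bounded_enlarge Fv d0 Fd M; exists (C' + C') => s s1.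
have FC1 t : 0 <= t <= 1 -> `|F (set_coord w i t)| <= C'.
  move=> /andP[t0 t1]; apply: FC => j; rewrite nneg_set_coord//= mxE.
  case: ifP => _; first by rewrite (le_trans t1)// lerDl sumr_ge0.
  by rewrite /M (bigD1 j)//= addrCA lerDl addr_ge0// sumr_ge0.
by rewrite (le_trans (ler_normB _ _))// lerD// FC1// lexx ler01.
Qed.

(** Replacing the constants c by the components of W one at a time, each step is
    an affine combination of two functions already known to be continuous, with
    the continuous coefficient W _ 0 i. *)
Lemma continuous_affine_comp (T : topologicalType) (W : T -> 'rV[R]_n) F :
  coordwise_affine F -> (forall x, nneg (W x)) ->
  (forall i, continuous (fun x => W x 0 i)) ->
  continuous (F \o W).
Proof.
move=> Fa W0 Wc.
pose mix k (c : 'rV[R]_n) x : 'rV[R]_n := \row_j (if (j < k)%N then W x 0 j else c 0 j).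
have mix_continuous k c : (k <= n)%N -> nneg c -> continuous (F \o mix k c).
  elim: k c => [|k IH] c kn c0.
    have -> : F \o mix 0%N c = cst (F c).
      by apply/funext => x /=; congr F; apply/rowP => j; rewrite mxE.
    exact: cst_continuous.
  pose i := Ordinal kn.
  have mixS x : mix k.+1 c x = set_coord (mix k c x) i (W x 0 i).
    apply/rowP => j; rewrite !mxE ltnS leq_eqVlt -val_eqE /=.
    by case: (eqVneq (j : nat) k) => //= jk; congr (W x 0 _); apply/val_inj.
  have mix_set s x : set_coord (mix k c x) i s = mix k (set_coord c i s) x.
    apply/rowP => j; rewrite !mxE; case: (eqVneq j i) => [->|//].
    by rewrite ltnn.
  have mix0 x : nneg (mix k c x) by move=> j; rewrite mxE; case: ifP => // _; exact: W0.
  have -> : F \o mix k.+1 c = fun x => F (mix k (set_coord c i 0) x) +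
      W x 0 i * (F (mix k (set_coord c i 1) x) - F (mix k (set_coord c i 0) x)).
    by apply/funext => x /=; rewrite mixS Fa ?W0// !mix_set.
  have c1 := IH (set_coord c i 1) (ltnW kn) (nneg_set_coord i c0 ler01).
  have c00 := IH (set_coord c i 0) (ltnW kn) (nneg_set_coord i c0 (lexx 0)).
  move=> x; apply: cvgD; first exact: c00.
  apply: cvgM; first exact: Wc.
  by apply: cvgB; [exact: c1|exact: c00].
have -> : W = mix n 0 by apply/funext => x; apply/rowP => j; rewrite mxE ltn_ord.
by apply: mix_continuous => // j; rewrite mxE.
Qed.

End Coordinatewise.

(** * Boxes, their widths and the Hausdorff distance *)

Section Boxes.
Context {R : realType} {n : nat} (e : n.-tuple 'rV[R]_n).
Hypothesis he : basis_of fullv e.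
Implicit Types (a c t u v w x : 'rV[R]_n) (i j : 'I_n) (s r eps : R).

Lemma lincombB t u : lincomb e (t - u) = lincomb e t - lincomb e u.
Proof.
by rewrite /lincomb -sumrB; apply: eq_bigr => i _; rewrite !mxE scalerBl.
Qed.

Lemma lincombD t u : lincomb e (t + u) = lincomb e t + lincomb e u.
Proof.
by rewrite /lincomb -big_split; apply: eq_bigr => i _; rewrite !mxE scalerDl.
Qed.

Lemma lincomb0 : lincomb e 0 = 0.
Proof. by rewrite /lincomb big1// => i _; rewrite mxE scale0r. Qed.

Lemma lincomb_set_coord t i r :
  lincomb e t - lincomb e (set_coord t i r) = (t 0 i - r) *: e`_i.
Proof.
rewrite -lincombB /lincomb (bigD1 i)//= !mxE eqxx big1 ?addr0// => j ji.
by rewrite !mxE (negbTE ji) subrr scale0r.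
Qed.

Lemma coord_lincomb i t : coord e i (lincomb e t) = t 0 i.
Proof. exact: (coord_sum_free (fun i => t 0 i) i (basis_free he)). Qed.

(** A linear functional is bounded by the sum of its absolute values at the
    canonical basis, since |x_k| is at most the Euclidean norm of x. *)
Lemma coord_lipschitz : exists2 M : R, 0 <= M &
  forall i x, `|coord e i x| <= M * enorm x.
Proof.
pose M i := \sum_k `|coord e i (delta_mx 0 k)|.
exists (\sum_i M i) => [|i x]; first by do 2 apply: sumr_ge0 => ? _.
have M0 j : 0 <= M j by apply: sumr_ge0.
apply: (@le_trans _ _ (M i * enorm x)); last first.
  by rewrite ler_wpM2r ?enorm_ge0// (bigD1 i)//= lerDl sumr_ge0.
rewrite {1}(row_sum_delta x) linear_sum /= mulr_suml.
apply: (le_trans (ler_norm_sum _ _ _)); apply: ler_sum => k _.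
rewrite linearZ/= normrM mulrC ler_wpM2l// -sqrtr_sqr ler_wsqrtr//.
by rewrite (bigD1 k)//= lerDl sumr_ge0// => j _; exact: sqr_ge0.
Qed.

(** The absolute value makes the box with corner a and widths w defined for
    every w, so that functions of the widths live on a whole vector space. *)
Lemma is_para_box a w :
  is_para e (parallelotope e a (a + map_mx (fun s => `|s|) w)).
Proof. by exists a, (a + map_mx (fun s => `|s|) w); split=> // i; rewrite !mxE lerDl. Qed.

Definition box a w : para e := Para (is_para_box a w).

Lemma boxP a w t :
  (box a w : set _) (lincomb e t) <-> forall i, a 0 i <= t 0 i <= a 0 i + `|w 0 i|.
Proof.
by split=> [/(parallelotopeP _ _ _ he) h i|h];
  [have := h i|apply/(parallelotopeP _ _ _ he) => i; have := h i]; rewrite !mxE.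
Qed.

Lemma lincomb_surj x : exists t, x = lincomb e t.
Proof. by exists (\row_i coord e i x); exact: basis_coordE. Qed.

Lemma para_box_exists (K : para e) : exists w, nneg w /\ exists a, K = box a w.
Proof.
have [a [b [ab Kab]]] := para_setP K; exists (b - a); split.
  by move=> i; rewrite !mxE subr_ge0.
exists a; apply: para_inj; rewrite Kab /=; congr (parallelotope e a _).
by apply/rowP => i; rewrite !mxE ger0_norm ?subr_ge0// addrC subrK.
Qed.

Definition widths (K : para e) : 'rV[R]_n := sval (cid (para_box_exists K)).

Lemma nneg_widths K : nneg (widths K).
Proof. by rewrite /widths; case: cid => w []. Qed.

Lemma para_boxE K : exists a, K = box a (widths K).
Proof. by rewrite /widths; case: cid => w []. Qed.

Lemma box_translate a w : box a w = [set y + lincomb e a | y in box 0 w] :> set _.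
Proof.
apply/seteqP; split=> x.
  have [t ->] := lincomb_surj x => /boxP h.
  exists (lincomb e (t - a)); last by rewrite -lincombD subrK.
  by apply/boxP => i; have := h i; rewrite !mxE => /andP[? ?]; apply/andP; split; lra.
move=> [y]; have [t ->] := lincomb_surj y => /boxP h <-.
rewrite -lincombD; apply/boxP => i.
by have := h i; rewrite !mxE => /andP[? ?]; apply/andP; split; lra.
Qed.

(** Compare the coordinates of the two extreme corners of the first box with
    those of nearby points of the second one. *)
Lemma box_sub_thickening a w c v eps M : 0 <= eps -> 0 <= M ->
  (forall i x, `|coord e i x| <= M * enorm x) ->
  (box a w : set _) `<=` thickening (box c v) eps ->
  forall i, c 0 i - M * eps <= a 0 i /\
    a 0 i + `|w 0 i| <= c 0 i + `|v 0 i| + M * eps.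
Proof.
move=> eps0 M0 Mc sub i.
have H t : (forall i, a 0 i <= t 0 i <= a 0 i + `|w 0 i|) ->
    c 0 i - M * eps <= t 0 i <= c 0 i + `|v 0 i| + M * eps.
  move=> /boxP /sub /(thickeningP _ _ eps0)[y].
  have [u ->] := lincomb_surj y => /boxP /(_ i) /andP[cu uc] tu.
  have : `|t 0 i - u 0 i| <= M * eps.
    rewrite -!coord_lincomb -linearB (le_trans (Mc _ _))//.
    by rewrite ler_wpM2l.
  by rewrite ler_norml => /andP[? ?]; apply/andP; split; lra.
have /H/andP[ca _] : forall j, a 0 j <= a 0 j <= a 0 j + `|w 0 j|.
  by move=> j; rewrite lexx lerDl normr_ge0.
have /(H (a + map_mx (fun s => `|s|) w))/andP[_] : forall j,
    a 0 j <= (a + map_mx (fun s => `|s|) w) 0 j <= a 0 j + `|w 0 j|.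
  by move=> j; rewrite !mxE lexx lerDl normr_ge0.
by rewrite !mxE.
Qed.

Lemma widths_lipschitz : exists2 M : R, 0 <= M &
  forall K L i, `|widths K 0 i - widths L 0 i| <= M * hausdorff_dist K L.
Proof.
have [M M0 Mc] := coord_lipschitz; exists (M + M); first exact: addr_ge0.
move=> K L i; set d := hausdorff_dist K L.
have [d0 KL LK] : hausdorff_bounds K L d.
  by apply: hausdorff_dist_attained;
    [exact: is_para_nonempty (para_setP _)|exact: is_para_compact (para_setP _)
    |exact: is_para_nonempty (para_setP _)|exact: is_para_compact (para_setP _)].
have [a Ka] := para_boxE K; have [c Lc] := para_boxE L.
rewrite Ka Lc in KL LK.
have wK := ger0_norm (nneg_widths K i); have wL := ger0_norm (nneg_widths L i).
have [] := box_sub_thickening d0 M0 Mc KL i; rewrite wK wL => ? ?.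
have [] := box_sub_thickening d0 M0 Mc LK i; rewrite wK wL => ? ?.
by rewrite ler_norml; apply/andP; split; lra.
Qed.

Lemma continuous_widths i : continuous (fun K : para e => widths K 0 i).
Proof.
have [M M0 ML] := widths_lipschitz; move=> K.
apply/(@cvgrPdist_le _ _ _ _ (nbhs_filter K)) => eps eps0; apply/nbhs_ballP.
(* M + 1 instead of M, which may vanish. *)
exists (eps / (M + 1)) => /=; first by rewrite divr_gt0// ltr_wpDl.
move=> L; rewrite ballEmdist /= => KL.
rewrite (le_trans (ML K L i))// -para_mdistE.
rewrite (@le_trans _ _ ((M + 1) * mdist K L))//.
  by rewrite ler_wpM2r ?mdist_ge0// lerDl.
by rewrite mulrC -ler_pdivlMr ?ltr_wpDl// ltW.
Qed.

(** Only the i-th coordinate of a point has to be truncated, from at most |s| to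
    at most |r|. *)
Lemma box_set_coord_thickening w i s r :
  (box 0 (set_coord w i s) : set _) `<=`
  thickening (box 0 (set_coord w i r)) (`|s - r| * enorm e`_i).
Proof.
move=> x; have [t ->] := lincomb_surj x => /boxP h.
have ti : 0 <= t 0 i <= `|s| by have := h i; rewrite !mxE eqxx add0r.
apply/thickeningP; first by rewrite mulr_ge0 ?enorm_ge0.
exists (lincomb e (set_coord t i (Num.min (t 0 i) `|r|))).
  apply/boxP => j; have := h j; rewrite !mxE; case: eqP => // _ _.
  by rewrite add0r le_min ge_min lexx orbT normr_ge0; case/andP: ti => ->.
rewrite lincomb_set_coord enormZ ler_wpM2r ?enorm_ge0//.
have := ler_dist_dist s r; rewrite ler_norml => /andP[_ sr].
rewrite ger0_norm ?subr_ge0 ?ge_min ?lexx//.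
case/andP: ti => ? ?; have := normr_ge0 (s - r).
by rewrite lerBlDl /Num.min; case: ifP => _ ?; lra.
Qed.

Lemma continuous_box_set_coord w i :
  continuous (fun s => box 0 (set_coord w i s)).
Proof.
move=> s; apply/cvg_ballP => eps eps0; pose E := enorm e`_i.
have E0 : 0 <= E := enorm_ge0 _.
apply/nbhs_ballP; exists (eps / (E + 1)) => /=; first by rewrite divr_gt0// ltr_wpDl.
move=> r /= sr; rewrite ballEmdist /= para_mdistE.
have le_d : hausdorff_dist (box 0 (set_coord w i s)) (box 0 (set_coord w i r)) <=
    `|s - r| * E.
  apply: hausdorff_dist_le; split; first by rewrite mulr_ge0.
    exact: box_set_coord_thickening.
  by rewrite distrC; exact: box_set_coord_thickening.
apply: (le_lt_trans le_d); apply: (@le_lt_trans _ _ (`|s - r| * (E + 1))).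
  by rewrite ler_wpM2l// lerDl.
by rewrite -ltr_pdivlMr ?ltr_wpDl.
Qed.

(** All the points of a box are within d * \sum_i |e_i| of its corner, where d
    bounds the widths. *)
Lemma sub_box_interior (U : set 'rV[R]_n) : U° !=set0 ->
  exists a d, 0 < d /\
    forall w, (forall i, 0 <= w 0 i <= d) -> (box a w : set _) `<=` U.
Proof.
case=> x; rewrite /interior => /nbhs_ballP[d0 /= d00 dU].
have [a ax] := lincomb_surj x; pose S := \sum_(i < n) `|e`_i|.
have S0 : 0 <= S by exact: sumr_ge0.
exists a, (d0 / (S + 1)); split=> [|w wd y]; first by rewrite divr_gt0// ltr_wpDl.
have [t ->] := lincomb_surj y => /boxP h; apply: dU.
rewrite -ball_normE /= ax -lincombB.
apply: (@le_lt_trans _ _ (d0 / (S + 1) * S)); last first.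
  by rewrite mulrAC -mulrA gtr_pMr// ltr_pdivrMr ?ltr_wpDl// mul1r ltrDl.
rewrite (le_trans (ler_norm_sum _ _ _))// mulr_sumr; apply: ler_sum => i _.
rewrite normrZ ler_wpM2r// !mxE distrC.
have /andP[? ?] := h i; have /andP[w0 wi] := wd i.
rewrite ger0_norm ?subr_ge0// lerBlDl (le_trans (andP (h i)).2)//.
by rewrite lerD2l ger0_norm.
Qed.

End Boxes.

(** * Translation invariant valuations *)

Section Valuation.
Context {R : realType} {n : nat} {e : n.-tuple 'rV[R]_n}.
Hypothesis he : basis_of fullv e.
Variable V : para e -> R.
Hypotheses (hV : is_valuation V) (htV : translation_invariant V).
Implicit Types (a w : 'rV[R]_n) (i : 'I_n) (s t : R).

Let F w := V (box e 0 w).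

Lemma valuation_box a w : V (box e a w) = V (box e 0 w).
Proof. exact: htV (box_translate he a w). Qed.

Lemma valuation_widths : V = F \o @widths R n e.
Proof.
by apply/funext => K /=; have [a {1}->] := para_boxE K; exact: valuation_box.
Qed.

(** The box of i-th width s + t is cut into a box of i-th width s and a translate
    of a box of i-th width t, which meet in a translate of the box of i-th
    width 0. *)
Lemma coordwise_valuation_box : coordwise_valuation F.
Proof.
move=> w i s t w0 s0 t0; pose a : 'rV[R]_n := set_coord 0 i s.
have -> : F (set_coord w i t) = V (box e a (set_coord w i t)).
  by rewrite valuation_box.
have -> : F (set_coord w i 0) = V (box e a (set_coord w i 0)).
  by rewrite valuation_box.
apply: hV.
- apply/seteqP; split=> x.
    have [u ->] := lincomb_surj he x => /(boxP he) h.
    have [us|us] := leP (u 0 i) s; [left|right]; apply/(boxP he) => j;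
      have := h j; rewrite !mxE; case: eqP => [->|//]; rewrite !ger0_norm ?addr_ge0//;
      move=> /andP[? ?]; apply/andP; split; lra.
  have [u ->] := lincomb_surj he x.
  by case=> /(boxP he) h; apply/(boxP he) => j; have := h j;
    rewrite !mxE; case: eqP => [->|//]; rewrite !ger0_norm ?addr_ge0//;
    move=> /andP[? ?]; apply/andP; split; lra.
- apply/seteqP; split=> x.
    have [u ->] := lincomb_surj he x => /(boxP he) h.
    by split; apply/(boxP he) => j; have := h j;
      rewrite !mxE; case: eqP => [->|//]; rewrite ?normr0 ?ger0_norm//;
      move=> /andP[? ?]; apply/andP; split; lra.
  have [u ->] := lincomb_surj he x => -[/(boxP he) h1 /(boxP he) h2].
  apply/(boxP he) => j; have := h1 j; have := h2 j.
  rewrite !mxE; case: eqP => [->|//]; rewrite ?normr0 ?ger0_norm//.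
  by move=> /andP[? ?] /andP[? ?]; apply/andP; split; lra.
Qed.

Lemma affine_continuous : coordwise_affine F -> continuous V.
Proof.
move=> Fa; rewrite valuation_widths; apply: continuous_affine_comp => //.
- exact: nneg_widths.
- exact: continuous_widths.
Qed.

(** Parallelotopes contained in a small ball around 0 are close to the singleton
    {0} in the Hausdorff distance. *)
Lemma continuous_bounded : continuous V -> exists U : set 'rV[R]_n, U° !=set0 /\
  (ereal_sup [set `|V K|%:E | K in [set K : para e | (K : set _) `<=` U]] < +oo)%E.
Proof.
move=> cV; pose K0 := box e 0 0.
have /cvgrPdist_lt/(_ 1 ltr01)/nbhs_ballP[d /= d0 dV] := cV K0.
(* Half the radius, because the Hausdorff distance of {0} to a set contained in
   an open ball is only known to be at most its radius. *)
exists [set x | enorm x < d / 2]; split.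
  exists 0; rewrite /interior /=.
  have /cvgrPdist_lt/(_ (d / 2)) := @enorm_continuous R n 0.
  rewrite divr_gt0// => /(_ isT); apply: filterS => x /=.
  by rewrite enorm0 sub0r normrN ger0_norm ?enorm_ge0.
apply: (@le_lt_trans _ _ (`|V K0| + 1)%:E); last exact: ltry.
apply: ge_ereal_sup => _ [K /= KU <-]; rewrite lee_fin.
have : `|V K0 - V K| < 1.
  apply: dV; rewrite ballEmdist /= para_mdistE.
  apply: (@le_lt_trans _ _ (d / 2)); last by rewrite ltr_pdivrMr// ltr_pMr// ltr1n.
  have d20 : 0 <= d / 2 by rewrite divr_ge0// ltW.
  have K00 : (K0 : set _) 0.
    by rewrite -(lincomb0 e); apply/(boxP he) => i; rewrite !mxE normr0 addr0 lexx.
  have K0E x : (K0 : set _) x -> x = 0.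
    have [t ->] := lincomb_surj he x => /(boxP he) t0.
    rewrite -(lincomb0 e); congr lincomb; apply/rowP => i.
    by apply/eqP; have := t0 i; rewrite !mxE normr0 addr0 -eq_le eq_sym.
  apply: hausdorff_dist_le; split=> // x.
    move=> /K0E ->; apply/thickeningP => //.
    have [y Ky] := is_para_nonempty (para_setP K); exists y => //.
    by rewrite sub0r enormN ltW//; exact: KU.
  by move=> Kx; apply/thickeningP => //; exists 0; rewrite // subr0 ltW//; exact: KU.
rewrite distrC => /ltW VK; rewrite -lerBlDl (le_trans _ VK)//.
by rewrite (le_trans (lerB_dist _ _)).
Qed.

Lemma bounded_continuous (U : set 'rV[R]_n) : U° !=set0 ->
  (ereal_sup [set `|V K|%:E | K in [set K : para e | (K : set _) `<=` U]] < +oo)%E ->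
  continuous V.
Proof.
move=> /(sub_box_interior he)[a [d [d0 dU]]] VU; apply: affine_continuous.
set A := [set _ | _ in _] in VU.
apply: (@bounded_affine _ _ F d (fine (ereal_sup A))) => // [|w wd].
  exact: coordwise_valuation_box.
have AF : A `|F w|%:E.
  by exists (box e a w); [exact: dU|rewrite valuation_box].
rewrite -lee_fin fineK; first exact: ereal_sup_ubound.
by rewrite fin_numElt VU andbT (lt_le_trans _ (ereal_sup_ubound AF))// ltNyr.
Qed.

(** Boxes depend continuously on each width, so V is Borel along each of these
    lines, and measurable solutions of Cauchy's equation are linear. *)
Lemma borel_continuous : borel_measurable V -> continuous V.
Proof.
move=> mV; apply: affine_continuous.
apply: measurable_affine => [|w i w0]; first exact: coordwise_valuation_box.
pose T := g_sigma_algebraType (@open (para e)).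
pose b : R -> T := fun s => box e 0 (set_coord w i s).
suff mb : measurable_fun setT b by exact: (measurableT_comp mV mb).
apply: (measurability (@open (para e) : set (set T))) => // _ [B oB <-].
rewrite setTI; apply: open_measurable.
by apply: open_comp => // s _; exact: (continuous_box_set_coord he).
Qed.

Lemma continuous_borel : continuous V -> borel_measurable V.
Proof.
move=> cV; apply: (measurability (@RGenOInfty.G R)).
  exact: RGenOInfty.measurableE.
move=> _ [_ [r ->] <-]; rewrite setTI; apply: sub_sigma_algebra.
by apply: open_comp => // K _; exact: cV.
Qed.

End Valuation.

Theorem theorem3p9 (R : realType) (n : nat) (e : n.-tuple 'rV[R]_n)
    (he : basis_of fullv e) (V : para e -> R)
    (hV : is_valuation V) (htV : translation_invariant V) :
  [<-> continuous V;
       exists U : set 'rV[R]_n, U° !=set0 /\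
         (ereal_sup [set `|V K|%:E | K in [set K : para e | K `<=` U]] < +oo)%E;
       borel_measurable V].
Proof.
tfae.
- exact: continuous_bounded.
- by move=> [U [U0 VU]]; apply: continuous_borel; exact: bounded_continuous U0 VU.
- exact: borel_continuous.
Qed.
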